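(* For all real numbers $a,b$ the following identities hold: $$\text{(a)}\quad \int_0^{\infty} x\sin(\pi x)\,s_{-1,x}(a)\,s_{0,x}(b)\, dx=\frac{\pi^2}{4}\left[\mathbf{H}_0(a-b)-\mathbf{H}_0(a+b)\right],$$ $$\text{(a$'$)}\quad \int_0^{\infty}x \sin(\pi x)\,s_{-1,x}(a)\, s_{0,x}(a)\,dx=-\frac{\pi^2}{4}\mathbf{H}_0(2a),$$ $$\text{(b)}\quad \int_0^{\infty}\cos^2\!\left(\frac{\pi x}{2}\right)s_{0,x}(a)\,s_{0,x}(b)\,dx=\frac{\pi^2}{8}\left[J_0(|a-b|)-J_0(a+b)\right],$$ $$\text{(b$'$)}\quad \int_0^{\infty}\cos^2\!\left(\frac{\pi x}{2}\right) s_{0,x}(a)^2\, dx=\frac{\pi^2}{8}\left(1-J_0(2a)\right),$$ $$\text{(c)}\quad \int_0^{\infty}x^2\sin^2\!\left(\frac{\pi x}{2}\right)s_{-1,x}(a)\,s_{-1,x}(b)\,dx=\frac{\pi^2}{8}\left[J_0(|a-b|)+J_0(a+b)\right],$$ $$\text{(c$'$)}\quad \int_0^{\infty} x^2\sin^2\!\left(\frac{\pi x}{2}\right) s_{-1,x}(a)^2\,dx=\frac{\pi^2}{8}\left(1+J_0(2a)\right).$$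
   Context: The Lommel function is $$s_{\mu,\nu}(z)= \frac{z^{\mu+1}}{(\mu+1)^2-\nu^2}\;{}_1F_2\left(1;\frac{\mu-\nu+3}{2},\frac{\mu+\nu+3}{2};-\frac{z^2}{4}\right),$$ where ${}_1F_2(\alpha;\beta,\gamma;w)=\sum_{k\ge 0}\frac{(\alpha)_k}{(\beta)_k(\gamma)_k}\frac{w^k}{k!}$ and $(\alpha)_k$ is the Pochhammer symbol. For $\mu=-1$ the factor $z^{\mu+1}$ equals $1$. As a function of the index $x\ge 0$, $s_{0,x}$ is undefined at odd integers $x$ and $s_{-1,x}$ at even integers $x$ (including $0$). At these isolated points the full integrands in the claim have removable singularities (the trigonometric and power factors cancel the poles), so the integrals are taken over the remaining $x$. $J_0$ is the Bessel function of the first kind of order $0$. $\mathbf{H}_0$ is the Struve function of order $0$, $\mathbf{H}_0(z)=\frac{2}{\pi}\int_0^{\pi/2}\sin(z\cos\theta)\,d\theta$, which is an odd entire function. *)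

(* Defs.v *)
From HB Require Import structures.
From mathcomp Require Import all_boot all_order all_algebra.
From mathcomp Require Import all_classical all_reals all_analysis.

Set Implicit Arguments.
Unset Strict Implicit.
Unset Printing Implicit Defensive.

Import Order.TTheory GRing.Theory Num.Theory.
Import numFieldNormedType.Exports.

Local Open Scope classical_set_scope.
Local Open Scope ring_scope.

Section SpecialFunctions.
Context {R : realType}.

Definition pochhammer (a : R) (k : nat) : R := \prod_(i < k) (a + i%:R).

Definition hyp1F2 (a b c w : R) : R :=
  limn (series (fun k : nat =>
    pochhammer a k / (pochhammer b k * pochhammer c k) * (w ^+ k / k`!%:R))).

(* The first index is an integer, so that z ^ (mu + 1) (a power with integer
   exponent, equal to 1 when mu = -1, also at z = 0) makes sense for every real
   argument z, including z < 0. The value is meaningless at the poles in nu. *)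
Definition lommel (mu : int) (nu z : R) : R :=
  z ^ (mu + 1) / ((mu%:~R + 1) ^+ 2 - nu ^+ 2) *
  hyp1F2 1 ((mu%:~R - nu + 3) / 2) ((mu%:~R + nu + 3) / 2) (- (z ^+ 2 / 4)).

Definition besselJ0 (z : R) : R :=
  limn (series (fun k : nat =>
    (-1) ^+ k / (k`!%:R ^+ 2) * (z / 2) ^+ (k.*2))).

Definition struveH0 (z : R) : R :=
  2 / pi *
  \int[@lebesgue_measure R]_(t in `[0, pi / 2]) sin (z * cos t).

Definition even_points : set R := [set x | exists n : nat, x = (n.*2)%:R].
Definition odd_points : set R := [set x | exists n : nat, x = (n.*2.+1)%:R].

(* Convergence of the (Lebesgue) integral is part of the claim. *)
Definition has_integral (D : set R) (f : R -> R) (v : R) : Prop :=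
  (@lebesgue_measure R).-integrable D (EFin \o f) /\
  \int[@lebesgue_measure R]_(x in D) f x = v.

End SpecialFunctions.

(* Main.v *)
Require Import Defs.
From HB Require Import structures.
From mathcomp Require Import all_boot all_order all_algebra.
From mathcomp Require Import all_classical all_reals all_analysis.
From mathcomp Require Import measurable_realfun ring.
Import Order.TTheory GRing.Theory Num.Theory.
Import numFieldNormedType.Exports.
Local Open Scope classical_set_scope.
Local Open Scope ring_scope.
Set Implicit Arguments.
Unset Strict Implicit.
Unset Printing Implicit Defensive.

(** The Lommel functions of index x are, up to a trigonometric factor, cosine
    transforms on the quarter period [0, pi/2]:

      cos (pi x / 2) s_(0,x)(z)      = int cos (x t) sin (z cos t) dt,
      - x sin (pi x / 2) s_(-1,x)(z) = int cos (x t) cos (z cos t) dt.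

    Since x sin (pi x) = 2 x sin (pi x / 2) cos (pi x / 2), each of the six
    integrands is, away from the excluded integers and up to a constant, a
    product of two such transforms. The Parseval identity

      int_0^oo F(x) G(x) dx = (pi / 2) int_0^(pi/2) f(t) g(t) dt

    turns the integral over x into the integral over t of a product of sines
    and cosines of a cos t and b cos t. Addition formulas and the integral
    representations of J_0 and H_0 finish the computation.

    The representations ([lommel0_cosine_transform],
    [lommelN1_cosine_transform]) come from expanding sin (z cos t) and
    cos (z cos t) in powers of z under the integral sign
    ([Rintegral_series]). The coefficients are the integrals of
    cos^n t cos (x t), and the recurrence (n + 2)^2 - x^2 : (n + 2)(n + 1)
    between those of orders n and n + 2 ([cosine_power_rec]) accounts
    for the ratio of consecutive terms of the hypergeometric series. The value x = 0
    gives the series of J_0.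

    Parseval ([parseval_cosine_transform]) is proved for C^1 functions. A
    transform decays only like 1/x, because the boundary value f(c) need not
    vanish, so the kernel cos (x s) cos (x t) cannot be integrated over x before
    s and t. One integration by parts replaces cos (x t) by sin (x t) / x, for
    which the product kernel is O(1/x^2) and Fubini applies
    ([cosine_transform_duality]). The only explicit improper integral that
    remains is that of sin (x s) sin (x t) / x^2, which is (pi/2) min(s, t)
    ([sine_kernel_integral]). It reduces by the product formula to
    int_0^oo (1 - cos (u x)) / x^2 dx = pi u / 2 ([fejer_integral]), where
    writing 1/x^2 as the integral of t exp (- x t) over t and exchanging
    (Tonelli) leaves int_0^oo u^2 / (t^2 + u^2) dt. *)

(** * Calculus on the real line *)

Section Calculus.
Context {R : realType}.
Notation mu := (@lebesgue_measure R).

Lemma is_derive_continuous (F f : R -> R) :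
  (forall x : R, is_derive x 1 F (f x)) -> continuous F.
Proof.
move=> dF x; apply: differentiable_continuous; apply/derivable1_diffP.
by have [] := dF x.
Qed.

Lemma continuous_segment_integrable (f : R -> R) (a b : R) :
  continuous f -> mu.-integrable `[a, b] (EFin \o f).
Proof.
move=> cf; apply: continuous_compact_integrable; first exact: segment_compact.
exact: continuous_subspaceT.
Qed.

Lemma Rintegral_FTC2 (F f : R -> R) (a b : R) : a <= b ->
  (forall x : R, is_derive x 1 F (f x)) -> continuous f ->
  \int[mu]_(x in `[a, b]) f x = F b - F a.
Proof.
rewrite le_eqVlt => /predU1P[->|ab] dF cf.
  by rewrite set_itv1 Rintegral_set1 subrr.
have cF := is_derive_continuous dF.
rewrite /Rintegral (@continuous_FTC2 _ f F a b ab) -?EFinB //.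
- exact: continuous_subspaceT.
- split; first by move=> x _; have [] := dF x.
    by apply: cvg_at_right_filter; exact: cF.
  by apply: cvg_at_left_filter; exact: cF.
- by move=> x _; rewrite derive1E; have [_ ->] := dF x.
Qed.

Lemma ge0_integral_FTC2y (F f : R -> R) (l : R) :
  (forall x, 0 <= x -> 0 <= f x) -> continuous f ->
  (forall x : R, is_derive x 1 F (f x)) -> F x @[x --> +oo] --> l ->
  (\int[mu]_(x in `]0%R, +oo[) (f x)%:E = (l - F 0)%:E)%E.
Proof.
move=> f0 cf dF Fl; have cF := is_derive_continuous dF.
rewrite integral_itv_obnd_cbnd; last first.
  apply/measurable_EFinP; apply: measurable_funTS.
  exact: continuous_measurable_fun.
rewrite (ge0_continuous_FTC2y f0 _ Fl) //=.
- exact: continuous_subspaceT.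
- by apply: cvg_at_right_filter; exact: cF.
- by move=> x _; rewrite derive1E; have [_ ->] := dF x.
Qed.

(** Inversion, extended by 0^-1 = 0, is continuous off 0, and a single point
    does not affect measurability. *)
Lemma measurable_funV_total : measurable_fun [set: R] (fun x : R => x^-1).
Proof.
rewrite -(setvU [set (0 : R)]); apply/measurable_funU => //.
  exact: measurableC.
split.
  apply: open_continuous_measurable_fun.
    by rewrite openC; exact: closed_eq.
  move=> x /[!inE] /= /eqP x0.
  exact: (@cvgV _ _ _ _ id x x0 cvg_id).
by apply: measurable_fun_set1.
Qed.

Lemma norm_sin_le (x : R) : `|sin x| <= `|x|.
Proof.
wlog x0 : x / 0 <= x.
  move=> H; have [/H//|x0] := leP 0 x.
  by rewrite -normrN -sinN -(normrN x); apply: H; rewrite oppr_ge0 ltW.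
have [<-|xn0] := eqVneq 0 x; first by rewrite sin0.
have x_gt0 : 0 < x by rewrite lt_neqAle xn0.
have [z _ ] := @MVT R sin cos 0 x x_gt0 (fun x _ => is_derive_sin x)
   (continuous_subspaceT (@continuous_sin R)).
rewrite sin0 !subr0 => ->; rewrite normrM (ger0_norm x0).
by rewrite ler_piMl // cos_max.
Qed.

Lemma cvg_mul_expRN (x : R) : 0 < x ->
  (t * expR (- (x * t)) @[t --> +oo] --> (0 : R)).
Proof.
move=> x0.
apply: (@squeeze_cvgr _ _ _ _ (cst 0) (fun t => 2 / x ^+ 2 * t^-1)).
- near=> t.
  have t0 : 0 < t by near: t; exact: nbhs_pinfty_gt.
  rewrite mulr_ge0 ?expR_ge0 ?(ltW t0) //= expRN.
  have xt : 0 < x * t by exact: mulr_gt0.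
  (* exp y >= y ^ 2 / 2 at y = x t leaves a bound of order 1 / t *)
  have := expR_ge1Dxn 1 (ltW xt).
  rewrite (_ : 2`!%:R = 2) // => H.
  rewrite ler_pdivrMr ?expR_gt0 //.
  apply: (@le_trans _ _ (2 / x ^+ 2 * t^-1 * ((x * t) ^+ 2 / 2))).
    rewrite le_eqVlt; apply/orP; left; apply/eqP; field.
    by rewrite !gt_eqF.
  rewrite ler_wpM2l ?mulr_ge0 ?invr_ge0 ?sqr_ge0 ?(ltW t0) //.
  by apply: le_trans H; rewrite lerDr.
- exact: cvg_cst.
- rewrite -[X in _ --> X](mulr0 (2 / x ^+ 2)).
  apply: cvgM; first exact: cvg_cst.
  apply/gtr0_cvgV0; last exact: cvg_id.
  by near=> t; near: t; exact: nbhs_pinfty_gt.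
Unshelve. all: by end_near. Qed.

End Calculus.

(** * Fubini and Tonelli on product sets *)

Section FubiniOnSets.
Context {R : realType}.
Notation mu := (@lebesgue_measure R).
Implicit Types (A B : set R) (F : R * R -> \bar R).

(** Extending the integrand by 0 outside A x B reduces iterated integrals over
    A and B to iterated integrals over the whole line. *)
Lemma section_restrictX1 A B F (x : R) :
  (\int[mu]_t (F \_ (A `*` B)) (x, t) =
  ((fun x => \int[mu]_(t in B) F (x, t)) \_ A) x)%E.
Proof.
rewrite patchE; case: ifPn => xA.
  rewrite [RHS]integral_mkcond; apply: eq_integral => t _.
  by rewrite !patchE in_setX /= xA.
apply: integral0_eq => t _; rewrite patchE in_setX /= (negbTE xA) //.
Qed.

Lemma section_restrictX2 A B F (t : R) :
  (\int[mu]_x (F \_ (A `*` B)) (x, t) =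
  ((fun t => \int[mu]_(x in A) F (x, t)) \_ B) t)%E.
Proof.
rewrite patchE; case: ifPn => tB.
  rewrite [RHS]integral_mkcond; apply: eq_integral => x _.
  by rewrite !patchE in_setX /= tB andbT.
by apply: integral0_eq => x _; rewrite patchE in_setX /= (negbTE tB) andbF.
Qed.

Lemma measurable_restrictX A B F : measurable A -> measurable B ->
  measurable_fun setT F -> measurable_fun setT (F \_ (A `*` B)).
Proof.
move=> mA mB mF; apply/(measurable_restrictT F); first exact: measurableX.
exact: measurable_funTS.
Qed.

Lemma tonelli_on A B F : measurable A -> measurable B ->
  measurable_fun setT F -> (forall x t, A x -> B t -> (0 <= F (x, t))%E) ->
  (\int[mu]_(x in A) \int[mu]_(t in B) F (x, t) =
   \int[mu]_(t in B) \int[mu]_(x in A) F (x, t))%E.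
Proof.
move=> mA mB mF F0; rewrite integral_mkcond [RHS]integral_mkcond.
transitivity (\int[mu]_x \int[mu]_t (F \_ (A `*` B)) (x, t))%E.
  by apply: eq_integral => x _; rewrite section_restrictX1.
rewrite (fubini_tonelli (m1 := mu) (m2 := mu) (F \_ (A `*` B))) /=.
- by apply: eq_integral => x _; rewrite section_restrictX2.
- exact: measurable_restrictX.
- move=> [x t]; rewrite patchE; case: ifPn => //.
  by rewrite in_setX /= => /andP[/[!inE] Ax Bt]; exact: F0.
Qed.

(** The bound by a function of x alone, integrable on A, together with
    mu B < +oo, is what makes the extended integrand integrable. *)
Lemma fubini_on A B (f : R -> R -> R) (k : R -> R) :
  measurable A -> measurable B -> (mu B < +oo)%E ->
  measurable_fun setT (fun p : R * R => f p.1 p.2) ->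
  mu.-integrable A (EFin \o k) ->
  (forall x t, A x -> B t -> `|f x t| <= k x) ->
  mu.-integrable A (fun x => (\int[mu]_(t in B) f x t)%:E) /\
  \int[mu]_(x in A) \int[mu]_(t in B) f x t =
  \int[mu]_(t in B) \int[mu]_(x in A) f x t.
Proof.
move=> mA mB Boo mf ik fk.
have mfE : measurable_fun setT (fun p : R * R => (f p.1 p.2)%:E).
  exact/measurable_EFinP.
have mf1 x : measurable_fun B (f x).
  apply: measurable_funTS.
  exact: (measurableT_comp mf (measurable_pair1 _)).
have mf2 t : measurable_fun A (f^~ t).
  apply: measurable_funTS.
  exact: (measurableT_comp mf (measurable_pair2 _)).
have if1 x : A x -> mu.-integrable B (EFin \o f x).
  move=> Ax; apply: measurable_bounded_integrable => //; first exact: mf1.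
  exists (k x); split; first exact: num_real.
  by move=> M kM t Bt; apply: le_trans (fk _ _ Ax Bt) _; exact: ltW.
have if2 t : B t -> mu.-integrable A (EFin \o f^~ t).
  move=> Bt; apply: (@le_integrable _ _ _ mu A mA _ _ _ _ ik).
    by apply/measurable_EFinP; exact: mf2.
  move=> x Ax /=; rewrite lee_fin; apply: le_trans (fk _ _ Ax Bt) _.
  exact: ler_norm.
pose F (p : R * R) := (f p.1 p.2)%:E.
have iF : (mu \x mu)%E.-integrable setT (F \_ (A `*` B)).
  apply/integrable12ltyP; first exact: measurable_restrictX.
  under eq_integral => x _.
    under eq_integral => t _.
      rewrite (_ : `|(F \_ (A `*` B)) (x, t)|%E =
          ((abse \o F) \_ (A `*` B)) (x, t)); last first.
        by rewrite !patchE; case: ifPn => //= _; rewrite normr0.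
      over.
    rewrite section_restrictX1; over.
  rewrite -integral_mkcond.
  apply: (@le_lt_trans _ _ (\int[mu]_(x in A) (k x * fine (mu B))%:E)%E).
    apply: ge0_le_integral => //.
    - by move=> x Ax; apply: integral_ge0 => t _; exact: abse_ge0.
    - apply: measurable_funTS.
      rewrite (_ : (fun x => _) = fubini_F mu ((abse \o F) \_ (setT `*` B))); last first.
        by apply/funext => x; rewrite /fubini_F section_restrictX1 patch_setT.
      apply: measurable_fun_fubini_tonelli_F.
        by apply: measurable_restrictX => //; exact: measurableT_comp.
      by move=> p; rewrite patchE; case: ifPn => // _; exact: abse_ge0.
    - move: ik => /integrableP[/measurable_EFinP mk _].
      by apply/measurable_EFinP; exact: measurable_funM.
    - move=> x Ax; rewrite EFinM fineK; last by rewrite ge0_fin_numE.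
      rewrite -integral_cst //.
      apply: ge0_le_integral => //.
      + by move=> t _; exact: abse_ge0.
      + apply: (@measurableT_comp _ _ _ _ _ _ abse _ (EFin \o f x)) => //.
        by apply/measurable_EFinP; exact: mf1.
      + by move=> t Bt; rewrite lee_fin fk.
  apply: integrable_lty => //.
  rewrite (_ : (fun _ => _) = (fun x => (k x)%:E * (fine (mu B))%:E)%E) //.
  exact: integrableZr.
have EB x : A x -> (\int[mu]_(t in B) f x t)%:E = (\int[mu]_(t in B) F (x, t))%E.
  by move=> Ax; rewrite /Rintegral fineK //; apply: integrable_fin_num => //; exact: if1.
have EA t : B t -> (\int[mu]_(x in A) f x t)%:E = (\int[mu]_(x in A) F (x, t))%E.
  by move=> Bt; rewrite /Rintegral fineK //; apply: integrable_fin_num => //; exact: if2.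
split.
  apply: (@eq_integrable _ _ _ mu A mA (fun x => (\int[mu]_(t in B) F (x, t))%E)).
    by move=> x /[!inE] /EB ->.
  apply: (proj2 (@integrable_mkcond _ _ _ mu A _ mA)).
  apply: eq_integrable (integrable_fubini_F iF) => // x _.
  by rewrite /fubini_F section_restrictX1.
congr fine.
transitivity (\int[mu]_(x in A) \int[mu]_(t in B) F (x, t))%E.
  by apply: eq_integral => x /[!inE] /EB ->.
transitivity (\int[mu]_(t in B) \int[mu]_(x in A) F (x, t))%E; last first.
  by apply: eq_integral => x /[!inE] /EA ->.
rewrite integral_mkcond [RHS]integral_mkcond.
transitivity (\int[mu]_x \int[mu]_t (F \_ (A `*` B)) (x, t))%E.
  by apply: eq_integral => x _; rewrite section_restrictX1.
by rewrite (Fubini iF); apply: eq_integral => x _; rewrite section_restrictX2.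
Qed.

(** The integrals of the positive and negative parts are measurable by Tonelli,
    and [fine] is measurable. *)
Lemma measurable_parametric_integral B (f : R -> R -> R) : measurable B ->
  measurable_fun setT (fun p : R * R => f p.1 p.2) ->
  measurable_fun setT (fun x => \int[mu]_(t in B) f x t).
Proof.
move=> mB mf; pose F (p : R * R) := (f p.1 p.2)%:E.
have mF : measurable_fun setT (F \_ (setT `*` B)).
  by apply: measurable_restrictX => //; exact/measurable_EFinP.
apply: (@measurableT_comp _ _ _ _ _ _ fine _
  (fun x => \int[mu]_(t in B) (f x t)%:E)%E); first exact: fine_measurable.
rewrite (_ : (fun x => _) = (fun x =>
    \int[mu]_t (F \_ (setT `*` B))^\+ (x, t)
    - \int[mu]_t (F \_ (setT `*` B))^\- (x, t))%E); last first.
  apply/funext => x; transitivity (\int[mu]_t (F \_ (setT `*` B)) (x, t))%E.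
    by rewrite section_restrictX1 patch_setT.
  by rewrite integralE; congr (_ - _)%E; apply: eq_integral => t _;
    rewrite ?funeposE ?funenegE.
by apply: emeasurable_funB; apply: measurable_fun_fubini_tonelli_F => //;
  [exact: measurable_funepos|exact: measurable_funeneg].
Qed.

End FubiniOnSets.

(** * The Fejer integral *)

Section PointwiseDerivatives.
Context {R : realType}.
Implicit Types (f g h : R -> R) (x a b c : R).

(** Not a type class, so that [derive_tac] keeps control of the shape of the
    derivative it builds. *)
Definition has_der f x a := is_derive x 1 f a.

Lemma der_eq f x a b : has_der f x a -> a = b -> is_derive x 1 f b.
Proof. by move=> fa <-. Qed.

Lemma der_cst c x : has_der (fun=> c) x 0.
Proof. exact: is_derive_cst. Qed.

Lemma der_id x : has_der (fun y => y) x 1.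
Proof. exact: is_derive_id. Qed.

Lemma derD f g x a b : has_der f x a -> has_der g x b ->
  has_der (fun y => f y + g y) x (a + b).
Proof. exact: is_deriveD. Qed.

Lemma derN f x a : has_der f x a -> has_der (fun y => - f y) x (- a).
Proof. exact: is_deriveN. Qed.

Lemma derM f g x a b : has_der f x a -> has_der g x b ->
  has_der (fun y => f y * g y) x (a * g x + f x * b).
Proof.
move=> fa gb; have H := is_deriveM fa gb; apply: is_derive_eq H _.
by rewrite /GRing.scale /= addrC mulrC.
Qed.

Lemma derX f x a n : has_der f x a ->
  has_der (fun y => f y ^+ n) x (n%:R * f x ^+ n.-1 * a).
Proof.
elim: n => [|n IH] fa; first by rewrite !mul0r; apply: der_cst.
have := derM fa (IH fa).
under eq_fun do rewrite -exprS; move=> H; apply: is_derive_eq H _.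
case: n {IH} => [|n]; first by rewrite !expr0; ring.
by rewrite /= exprS; ring.
Qed.

Lemma der_comp h f x a b : is_derive (f x) 1 h b -> has_der f x a ->
  has_der (fun y => h (f y)) x (b * a).
Proof. exact: is_derive1_comp. Qed.

Lemma der_sin f x a : has_der f x a ->
  has_der (fun y => sin (f y)) x (cos (f x) * a).
Proof. exact: der_comp. Qed.

Lemma der_cos f x a : has_der f x a ->
  has_der (fun y => cos (f y)) x (- sin (f x) * a).
Proof. exact: der_comp. Qed.

Lemma der_exp f x a : has_der f x a ->
  has_der (fun y => expR (f y)) x (expR (f x) * a).
Proof. exact: der_comp. Qed.

Lemma der_atan f x a : has_der f x a ->
  has_der (fun y => atan (f y)) x ((1 + f x ^+ 2)^-1 * a).
Proof. exact: der_comp. Qed.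

End PointwiseDerivatives.

(** Builds the derivative of an explicit expression; the goal left over compares
    it with the expected one. *)
Ltac derive_tac :=
  apply: der_eq;
  [repeat first [apply: der_cst | apply: der_id | apply: derX | apply: derN
    | apply: derD | apply: derM | apply: der_sin | apply: der_cos
    | apply: der_exp | apply: der_atan] | rewrite /=].

Section Fejer.
Context {R : realType}.
Notation mu := (@lebesgue_measure R).

(** The Laplace representation of c / x ^ 2; the factor c is carried along
    because it depends on x in the application. *)
Lemma laplace_t (x c : R) : 0 < x -> 0 <= c ->
  (\int[mu]_(t in `]0%R, +oo[) (t * expR (- (x * t)) * c)%:E = (c / x ^+ 2)%:E)%E.
Proof.
move=> x0 c0; have xn0 : x != 0 by rewrite gt_eqF.
pose F t : R := - (c / x) * (t * expR (- (x * t)))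
   - c / x ^+ 2 * expR (- (x * t)).
have dF (t : R) : is_derive t 1 F (t * expR (- (x * t)) * c).
  rewrite /F; derive_tac. by field.
rewrite (ge0_integral_FTC2y (F := F) (l := 0)).
- by rewrite /F !mulr0 oppr0 expR0 mul0r mulr0 mulr1 sub0r sub0r opprK.
- by move=> t t0; rewrite !mulr_ge0 ?expR_ge0.
- apply: (is_derive_continuous
    (f := fun t => expR (- (x * t)) * (1 - x * t) * c)) => t.
  by derive_tac; ring.
- rewrite [X in _ --> X](_ : 0 = - (c / x) * 0 - c / x ^+ 2 * 0 :> R); last by ring.
  apply: cvgB; apply: cvgM; try exact: cvg_cst; first exact: cvg_mul_expRN.
  apply: (cvg_comp (fun t => x * t) (fun t => expR (- t)) _ (cvgr_expR (R := R))).
  exact: (gt0_cvgMry x0 cvg_id).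
Qed.

Lemma continuous_bump (u : R) : 0 < u ->
  continuous (fun t : R => u ^+ 2 / (t ^+ 2 + u ^+ 2)).
Proof.
move=> u0 t.
apply: cvgM; first exact: cvg_cst.
apply: cvgV; first by rewrite gt_eqF // ltr_wpDl ?sqr_ge0 // exprn_gt0.
by apply: cvgD; [exact: exprn_continuous|exact: cvg_cst].
Qed.

Lemma laplace_x (t u : R) : 0 < t -> 0 < u ->
  (\int[mu]_(x in `]0%R, +oo[) (t * expR (- (x * t)) * (1 - cos (x * u)))%:E
  = (u ^+ 2 / (t ^+ 2 + u ^+ 2))%:E)%E.
Proof.
move=> t0 u0; have dn0 : t ^+ 2 + u ^+ 2 != 0.
  by rewrite gt_eqF // ltr_wpDl ?sqr_ge0 // exprn_gt0.
(* F = expR (- x t) * b is an antiderivative, and b is bounded *)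
pose b x : R := - 1 - t / (t ^+ 2 + u ^+ 2) * (u * sin (x * u) - t * cos (x * u)).
pose F x : R := expR (- (x * t)) * b x.
have dF (x : R) : is_derive x 1 F (t * expR (- (x * t)) * (1 - cos (x * u))).
  rewrite /F /b; derive_tac; by field.
rewrite (ge0_integral_FTC2y (F := F) (l := 0)).
- by rewrite /F /b !mul0r oppr0 expR0 sin0 cos0; congr EFin; field.
- move=> x x0; rewrite !mulr_ge0 ?expR_ge0 ?(ltW t0) // subr_ge0; exact: cos_le1.
- apply: (is_derive_continuous) => x; derive_tac; reflexivity.
- apply/norm_cvg0P.
  pose M := 1 + t / (t ^+ 2 + u ^+ 2) * (u + t).
  apply: (@squeeze_cvgr _ _ _ _ (cst 0) (fun x => expR (- (x * t)) * M)).
  + near=> x; rewrite normr_ge0 /= normrM (ger0_norm (expR_ge0 _)) ler_wpM2l ?expR_ge0 //.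
    rewrite /b /M (le_trans (ler_normB _ _)) // normrN1 lerD2l.
    rewrite normrM ger0_norm; last first.
      by rewrite divr_ge0 ?addr_ge0 ?sqr_ge0 ?(ltW t0).
    rewrite ler_wpM2l //; first by rewrite divr_ge0 ?addr_ge0 ?sqr_ge0 ?(ltW t0).
    rewrite (le_trans (ler_normB _ _)) // !normrM (gtr0_norm t0) (gtr0_norm u0).
    by rewrite lerD // ger_pMr // ?sin_max ?cos_max.
  + exact: cvg_cst.
  + rewrite [X in _ --> X](_ : 0 = 0 * M); last by rewrite mul0r.
    apply: cvgM; last exact: cvg_cst.
    apply: (cvg_comp (fun x => x * t) (fun x => expR (- x)) _ (cvgr_expR (R := R))).
    exact: (gt0_cvgMly t0 cvg_id).
Unshelve. all: by end_near. Qed.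

Lemma integral_bump (u : R) : 0 < u ->
  (\int[mu]_(t in `]0%R, +oo[) (u ^+ 2 / (t ^+ 2 + u ^+ 2))%:E = (pi / 2 * u)%:E)%E.
Proof.
move=> u0; have un0 : u != 0 by rewrite gt_eqF.
have dF (t : R) : is_derive t 1 (fun t => u * atan (t / u)) (u ^+ 2 / (t ^+ 2 + u ^+ 2)).
  derive_tac; field; rewrite un0 /= gt_eqF ?ltr_wpDl ?sqr_ge0 ?exprn_gt0 //.
rewrite (ge0_integral_FTC2y (F := fun t => u * atan (t / u)) (l := u * (pi / 2))).
- by rewrite mul0r atan0 mulr0 subr0 mulrC.
- by move=> t _; rewrite divr_ge0 ?addr_ge0 ?sqr_ge0.
- exact: continuous_bump.
- apply: cvgM; first exact: cvg_cst.
  apply: (cvg_comp (fun t => t / u) atan _ (cvgy_atan (R := R))).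
  by apply: gt0_cvgMly; rewrite ?invr_gt0 //; exact: cvg_id.
Qed.

(** Both orders of integration of t exp (- x t) (1 - cos (x u)), which is
    nonnegative, so that Tonelli applies. *)
Lemma fejer_integral (u : R) : 0 < u ->
  (\int[mu]_(x in `]0%R, +oo[) ((1 - cos (x * u)) / x ^+ 2)%:E = (pi / 2 * u)%:E)%E.
Proof.
move=> u0; pose F (p : R * R) :=
  (p.2 * expR (- (p.1 * p.2)) * (1 - cos (p.1 * u)))%:E.
have pos x : 0 <= 1 - cos (x * u) :> R by rewrite subr_ge0 cos_le1.
transitivity (\int[mu]_(x in `]0%R, +oo[) \int[mu]_(t in `]0%R, +oo[) F (x, t))%E.
  apply: eq_integral => x /[!inE] /=; rewrite in_itv /= andbT => x0.
  by rewrite /F /= laplace_t.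
rewrite tonelli_on //.
- rewrite -integral_bump //.
  apply: eq_integral => t /[!inE] /=; rewrite in_itv /= andbT => t0.
  by rewrite /F /= laplace_x.
- apply/measurable_EFinP; apply: measurable_funM.
    apply: measurable_funM; first exact: measurable_snd.
    apply: measurableT_comp => //; apply: measurableT_comp => //.
    by apply: measurable_funM; [exact: measurable_fst|exact: measurable_snd].
  apply: measurable_funB => //.
  apply: (measurableT_comp (continuous_measurable_fun (@continuous_cos R))).
  apply: measurable_funM => //; exact: measurable_fst.
- move=> x t /=; rewrite !in_itv /= !andbT => x0 t0.
  by rewrite lee_fin !mulr_ge0 ?expR_ge0 ?(ltW t0).
Qed.

End Fejer.

(** * The kernel sin (x t) / x and the cosine transform *)

Section KernelIntegral.
Context {R : realType}.
Notation mu := (@lebesgue_measure R).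

Definition sine_kernel (x t : R) : R := sin (x * t) / x.

(** |sin (x t)| <= x t controls small x and |sin (x t)| <= 1 controls large
    x; the two bounds add up to a single one that is square integrable. *)
Lemma sine_kernel_le (c x t : R) : 0 < x -> 0 <= t <= c ->
  `|sine_kernel x t| <= (c + 1) / (1 + x).
Proof.
move=> x0 /andP[t0 tc].
have x1 : 0 < 1 + x by rewrite addr_gt0.
rewrite ler_pdivlMr // mulrDr mulr1 addrC [leRHS]addrC lerD //.
  rewrite /sine_kernel normrM normfV (gtr0_norm x0) mulfVK ?gt_eqF //.
  exact: sin_max.
rewrite /sine_kernel normrM normfV (gtr0_norm x0) ler_pdivrMr //.
rewrite (le_trans (norm_sin_le _)) // normrM (gtr0_norm x0) (ger0_norm t0).
by rewrite mulrC ler_pM2r.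
Qed.

Lemma measurable_sine_kernel :
  measurable_fun setT (fun p : R * R => sine_kernel p.1 p.2).
Proof.
apply: measurable_funM.
  apply: (measurableT_comp (continuous_measurable_fun (@continuous_sin R))).
  by apply: measurable_funM; [exact: measurable_fst|exact: measurable_snd].
by apply: (measurableT_comp measurable_funV_total); exact: measurable_fst.
Qed.

(** (1 + x) ^ -2 is dominated by the derivative of the arctangent. *)
Lemma integrable_decay (h : R -> R) (K : R) : measurable_fun setT h ->
  (forall x, 0 < x -> `|h x| <= K / (1 + x) ^+ 2) ->
  mu.-integrable `]0, +oo[ (EFin \o h).
Proof.
move=> mh hK.
have i1 : mu.-integrable `[0, +oo[ (EFin \o (fun x => (oneDsqr x)^-1)).
  apply/integrableP; split.
    apply/measurable_EFinP; apply: measurable_funTS.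
    apply: continuous_measurable_fun; exact: continuous_oneDsqrV.
  under eq_integral => x _ do rewrite /= ger0_norm ?invr_ge0 ?ltW ?oneDsqr_gt0 //.
  by rewrite integral0y_oneDsqr ltry.
have i2 : mu.-integrable `]0, +oo[ (EFin \o (fun x => (oneDsqr x)^-1)).
  apply: integrableS i1 => // x /=; rewrite !in_itv /= !andbT; exact: ltW.
apply: (@le_integrable _ _ _ mu _ _ _
  (fun x => `|K|%:E * ((oneDsqr x)^-1)%:E)%E _ _) => //.
- by apply/measurable_EFinP; apply: measurable_funTS.
- move=> x /=; rewrite in_itv /= andbT => x0; rewrite lee_fin.
  apply: (le_trans (hK x x0)); rewrite normrM normr_id.
  apply: (@le_trans _ _ (`|K| / (1 + x) ^+ 2)).
    by rewrite ler_pM2r ?ler_norm // invr_gt0 exprn_gt0 // addr_gt0.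
  rewrite ler_wpM2l // [leRHS]ger0_norm ?invr_ge0 ?(ltW (oneDsqr_gt0 _)) //.
  have d0 : 0 < (1 + x) ^+ 2 by rewrite exprn_gt0 // addr_gt0.
  rewrite lef_pV2 ?posrE ?oneDsqr_gt0 //.
  by rewrite /oneDsqr sqrrD expr1n mul1r lerD2r lerDl mulrn_wge0 // ltW.
- exact: integrableZl.
Qed.

(** The case u = 0 is included because the product formula below produces
    u = t - s. *)
Lemma fejer_integrable (u : R) : 0 <= u ->
  mu.-integrable `]0, +oo[ (fun x => ((1 - cos (x * u)) / x ^+ 2)%:E) /\
  \int[mu]_(x in `]0, +oo[) ((1 - cos (x * u)) / x ^+ 2) = pi / 2 * u.
Proof.
rewrite le_eqVlt => /predU1P[<-|u0].
  have E : (fun x : R => (1 - cos (x * 0)) / x ^+ 2) = (fun=> 0).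
    by apply/funext => x; rewrite mulr0 cos0 subrr mul0r.
  split; last by rewrite E Rintegral_cst // mul0r mulr0.
  apply: eq_integrable (integrable0 mu _) => // x _ /=.
  by rewrite mulr0 cos0 subrr mul0r.
split; last by rewrite /Rintegral fejer_integral.
apply/integrableP; split.
  apply/measurable_EFinP; apply: measurable_funTS; apply: measurable_funM.
    apply: measurable_funB => //.
    apply: (measurableT_comp (continuous_measurable_fun (@continuous_cos R))).
    exact: measurable_funM.
  by apply: (measurableT_comp measurable_funV_total); exact: exprn_measurable.
under eq_integral => x _ do
  rewrite /= ger0_norm ?divr_ge0 ?sqr_ge0 ?subr_ge0 ?cos_le1 //.
by rewrite fejer_integral // ltry.
Qed.

(** The product formula 2 sin (x s) sin (x t) =
    cos (x (t - s)) - cos (x (t + s)) gives (pi / 4) (s + t - |t - s|). *)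
Lemma sine_kernel_integral (s t : R) : 0 <= s -> 0 <= t ->
  \int[mu]_(x in `]0, +oo[) (sine_kernel x s * sine_kernel x t)
  = pi / 2 * Num.min s t.
Proof.
wlog st : s t / s <= t => [H s0 t0|s0 t0].
  have [st|/ltW ts] := leP s t; first by have := H s t st s0 t0; rewrite min_l.
  by under eq_Rintegral do rewrite mulrC; rewrite H // min_l.
rewrite min_l //.
have [i1 E1] := fejer_integrable (addr_ge0 s0 t0).
have ts0 : 0 <= t - s by rewrite subr_ge0.
have [i2 E2] := fejer_integrable ts0.
transitivity (\int[mu]_(x in `]0, +oo[)
  (1 / 2 * ((1 - cos (x * (s + t))) / x ^+ 2 - (1 - cos (x * (t - s))) / x ^+ 2))).
  apply: eq_Rintegral => x /[!inE] /=; rewrite in_itv /= andbT => x0.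
  have xn0 : x != 0 by rewrite gt_eqF.
  by rewrite /sine_kernel (mulrDr x s t) (mulrBr x t s) cosD cosB; field.
rewrite RintegralZl //; last exact: (integrableB _ i1 i2).
by rewrite RintegralB // E1 E2; field.
Qed.

End KernelIntegral.

Section CosineTransform.
Context {R : realType}.
Notation mu := (@lebesgue_measure R).
Variable c : R.
Hypothesis c0 : 0 < c.

Definition cosine_transform (f : R -> R) (x : R) : R :=
  \int[mu]_(t in `[0, c]) (f t * cos (x * t)).

Lemma segment_bounded (f : R -> R) : continuous f ->
  exists2 M : R, 0 <= M & forall t, 0 <= t <= c -> `|f t| <= M.
Proof.
move=> cf.
have cn : {within `[0, c], continuous (fun t => `|f t|)}.
  apply: continuous_subspaceT => t.
  by apply: (@continuous_comp _ _ _ f Num.norm); [exact: cf|exact: norm_continuous].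
have [m _ fm] := EVT_max (ltW c0) cn.
by exists `|f m| => // t tc; apply: fm; rewrite in_itv.
Qed.

Lemma continuous_sine_kernel (x : R) : continuous (sine_kernel x).
Proof.
move=> t; apply: cvgM; last exact: cvg_cst.
apply: (@continuous_comp _ _ _ (fun t => x * t) sin); last exact: continuous_sin.
by apply: cvgM; [exact: cvg_cst|exact: cvg_id].
Qed.

Lemma continuous_cos_scale (x : R) : continuous (fun t => cos (x * t)).
Proof.
move=> t; apply: (@continuous_comp _ _ _ (fun t => x * t) cos);
  last exact: continuous_cos.
by apply: cvgM; [exact: cvg_cst|exact: cvg_id].
Qed.

Section ByParts.
Variables (g g' : R -> R).
Hypothesis dg : forall x : R, is_derive x 1 g (g' x).
Hypothesis cg' : continuous g'.
Let cg : continuous g := is_derive_continuous dg.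

Lemma cosine_transform_by_parts (x : R) : x != 0 ->
  cosine_transform g x =
  g c * sine_kernel x c - \int[mu]_(t in `[0, c]) (g' t * sine_kernel x t).
Proof.
move=> x0.
have c1 : continuous (fun t => g' t * sine_kernel x t).
  by move=> t; apply: cvgM; [exact: cg'|exact: continuous_sine_kernel].
have c2 : continuous (fun t => g t * cos (x * t)).
  by move=> t; apply: cvgM; [exact: cg|exact: continuous_cos_scale].
have d (t : R) : is_derive t 1 (fun t => g t * sine_kernel x t)
    (g' t * sine_kernel x t + g t * cos (x * t)).
  apply: der_eq; first (apply: derM; first exact: dg).
    apply: derM; last exact: der_cst.
    by apply: der_sin; apply: derM; [exact: der_cst|exact: der_id].
  by rewrite /=; field.
have cd : continuous (fun t => g' t * sine_kernel x t + g t * cos (x * t)).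
  by move=> t; apply: cvgD; [exact: c1|exact: c2].
have := Rintegral_FTC2 (ltW c0) d cd.
rewrite RintegralD //; try exact: continuous_segment_integrable.
rewrite addrC => /(canRL (addrK _)) E.
by rewrite [LHS]E /sine_kernel mulr0 sin0 mul0r mulr0 subr0.
Qed.

End ByParts.
End CosineTransform.

(** * The Parseval identity for cosine transforms *)

Section Duality.
Context {R : realType}.
Notation mu := (@lebesgue_measure R).
Variable c : R.
Hypothesis c0 : 0 < c.

(** The rate 1 / x cannot be improved in general, since g c may be nonzero. *)
Lemma cosine_transform_decay (g g' : R -> R) :
  (forall x : R, is_derive x 1 g (g' x)) -> continuous g' ->
  exists2 K : R, 0 <= K &
    forall x, 0 < x -> `|cosine_transform c g x| <= K / (1 + x).
Proof.
move=> dg cg'; have [M M0 hM] := segment_bounded c0 cg'.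
exists (`|g c| * (c + 1) + c * (M * (c + 1))).
  by rewrite addr_ge0 ?mulr_ge0 ?addr_ge0 // ltW.
move=> x x0; have x1 : 0 < 1 + x by rewrite addr_gt0.
have cc : 0 <= c <= c by rewrite (ltW c0) /=.
rewrite (cosine_transform_by_parts c0 dg cg') ?gt_eqF //.
rewrite (le_trans (ler_normB _ _)) // mulrDl lerD //.
  by rewrite normrM -mulrA ler_wpM2l // sine_kernel_le.
have ci : continuous (fun t => g' t * sine_kernel x t).
  by move=> t; apply: cvgM; [exact: cg'|exact: continuous_sine_kernel].
have ii := continuous_segment_integrable 0 c ci.
rewrite (le_trans (le_normr_Rintegral _ ii)) //.
apply: (@le_trans _ _ (\int[mu]_(t in `[0, c]) (M * (c + 1) / (1 + x)))).
  apply: le_Rintegral => //.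
  - exact: integrable_norm.
  - by apply: continuous_segment_integrable => ?; exact: cvg_cst.
  - move=> t /=; rewrite in_itv /= => tc; rewrite normrM -mulrA ler_pM //.
      exact: hM.
    exact: sine_kernel_le.
rewrite Rintegral_cst //= lebesgue_measure_itv /= lte_fin c0 oppr0 addr0.
by rewrite /= [leLHS]mulrC !mulrA.
Qed.

Lemma measurable_cosine_transform (g : R -> R) : continuous g ->
  measurable_fun setT (cosine_transform c g).
Proof.
move=> cg; apply: measurable_parametric_integral => //.
apply: measurable_funM.
  apply: (measurableT_comp (continuous_measurable_fun cg)).
  exact: measurable_snd.
apply: (measurableT_comp (continuous_measurable_fun (@continuous_cos R))).
by apply: measurable_funM; [exact: measurable_fst|exact: measurable_snd].
Qed.

(** Integrating against H commutes with the cosine transform once cos (x t)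
    has been integrated to sin (x t) / x: the integrand then decays like
    1 / x ^ 2 uniformly in t, and Fubini applies. The lemma is used twice, with
    H a sine kernel and then with H itself a cosine transform. *)
Lemma cosine_transform_duality (H g g' : R -> R) (K : R) :
  measurable_fun setT H -> 0 <= K ->
  (forall x, 0 < x -> `|H x| <= K / (1 + x)) ->
  (forall x : R, is_derive x 1 g (g' x)) -> continuous g' ->
  let Psi t := \int[mu]_(x in `]0, +oo[) (H x * sine_kernel x t) in
  mu.-integrable `]0, +oo[ (EFin \o (fun x => H x * cosine_transform c g x)) /\
  \int[mu]_(x in `]0, +oo[) (H x * cosine_transform c g x) =
  g c * Psi c - \int[mu]_(t in `[0, c]) (g' t * Psi t).
Proof.
move=> mH K0 HK dg cg' Psi.
have [M M0 hM] := segment_bounded c0 cg'.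
have cc : 0 <= c <= c by rewrite (ltW c0) /=.
have mker t : measurable_fun setT (fun x => H x * sine_kernel x t).
  apply: measurable_funM => //.
  exact: (measurableT_comp measurable_sine_kernel (measurable_pair2 t)).
have iker t : 0 <= t <= c ->
    mu.-integrable `]0, +oo[ (EFin \o (fun x => H x * sine_kernel x t)).
  move=> tc; apply: (@integrable_decay _ _ (K * (c + 1))) => // x x0.
  have x1 : 0 < 1 + x by rewrite addr_gt0.
  rewrite normrM (le_trans (ler_pM _ _ (HK x x0) (sine_kernel_le x0 tc))) //.
  rewrite le_eqVlt; apply/orP; left; apply/eqP; field.
  by rewrite gt_eqF.
pose f x t := H x * (g' t * sine_kernel x t).
have [if1 fubini] : mu.-integrable `]0, +oo[
     (fun x => (\int[mu]_(t in `[0, c]) f x t)%:E) /\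
   \int[mu]_(x in `]0, +oo[) \int[mu]_(t in `[0, c]) f x t =
   \int[mu]_(t in `[0, c]) \int[mu]_(x in `]0, +oo[) f x t.
  apply: (fubini_on (k := fun x => K * M * (c + 1) / (1 + x) ^+ 2)) => //.
  - by rewrite lebesgue_measure_itv /= lte_fin c0 -EFinB ltry.
  - apply: measurable_funM.
      exact: (measurableT_comp mH measurable_fst).
    apply: measurable_funM; last exact: measurable_sine_kernel.
    apply: (measurableT_comp (continuous_measurable_fun cg')).
    exact: measurable_snd.
  - apply: (@integrable_decay _ _ (K * M * (c + 1))) => [|x x0].
      apply: measurable_funM => //.
      apply: (measurableT_comp measurable_funV_total).
      apply: measurable_funX; exact: measurable_funD.
    rewrite /= ger0_norm // divr_ge0 ?sqr_ge0 //.
    by rewrite !mulr_ge0 // addr_ge0 // ltW.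
  - move=> x t /=; rewrite !in_itv /= andbT => x0 tc.
    have x1 : 0 < 1 + x by rewrite addr_gt0.
    rewrite /f normrM (normrM (g' t)).
    apply: (@le_trans _ _ (K / (1 + x) * (M * ((c + 1) / (1 + x))))).
      apply: ler_pM; rewrite ?mulr_ge0 //; first exact: HK.
      apply: ler_pM => //; [exact: hM|]. exact: (sine_kernel_le x0 tc).
    rewrite le_eqVlt; apply/orP; left; apply/eqP; field.
    by rewrite gt_eqF.
pose by_parts x :=
  g c * (H x * sine_kernel x c) - \int[mu]_(t in `[0, c]) f x t.
have E : {in `]0, +oo[, (fun x => H x * cosine_transform c g x) =1 by_parts}.
  move=> x; rewrite in_itv /= andbT => x0.
  rewrite (cosine_transform_by_parts c0 dg cg') ?gt_eqF // mulrBr mulrCA.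
  congr (_ - _); rewrite -RintegralZl //.
  apply: continuous_segment_integrable => t.
  by apply: cvgM; [exact: cg'|exact: continuous_sine_kernel].
have i1 : mu.-integrable `]0, +oo[ (EFin \o (fun x => g c * (H x * sine_kernel x c))).
  by have := integrableZl _ (g c) (iker c cc); apply.
split.
  apply: (@eq_integrable _ _ _ mu _ _ (EFin \o by_parts)) => //.
    by move=> x xI; rewrite /= E // -in_setE.
  by have := integrableB _ i1 if1; apply.
rewrite (@eq_Rintegral _ _ _ mu `]0, +oo[ by_parts); last first.
  by move=> x xI; rewrite /= E // -in_setE.
rewrite RintegralB // RintegralZl //; last exact: iker.
rewrite fubini; congr (_ - _).
apply: eq_Rintegral => t /[!inE] /=; rewrite in_itv /= => tc.
rewrite -RintegralZl //; last exact: iker.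
by apply: eq_Rintegral => x _; rewrite /f mulrCA.
Qed.

Section Parseval.
Variables (f f' g g' : R -> R).
Hypothesis df : forall x : R, is_derive x 1 f (f' x).
Hypothesis cf' : continuous f'.
Hypothesis dg : forall x : R, is_derive x 1 g (g' x).
Hypothesis cg' : continuous g'.
Let cf : continuous f := is_derive_continuous df.
Let cg : continuous g := is_derive_continuous dg.

(** Duality with H = sine_kernel^~ s, for which the pairing with
    sine_kernel^~ t is (pi / 2) min(s, t). Undoing the integration by parts on
    [0, s], and integrating f' on ]s, c], where min(s, t) is constant, recovers
    the integral of f. *)
Lemma sine_kernel_cosine_transform (s : R) : 0 <= s <= c ->
  \int[mu]_(x in `]0, +oo[) (cosine_transform c f x * sine_kernel x s)
  = pi / 2 * \int[mu]_(u in `[0, s]) f u.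
Proof.
move=> sc; have /andP[s0 s_c] := sc.
have ms : measurable_fun setT (sine_kernel^~ s).
  exact: (measurableT_comp measurable_sine_kernel (measurable_pair2 s)).
have c1 : 0 <= c + 1 by rewrite addr_ge0 // ltW.
have [_ E] := cosine_transform_duality ms c1
  (fun x x0 => sine_kernel_le x0 sc) df cf'.
under eq_Rintegral do rewrite mulrC.
rewrite E sine_kernel_integral // ?ltW // (min_l s_c).
have cmin : continuous (fun t : R => f' t * Num.min s t).
  move=> t; apply: cvgM; first exact: cf'.
  by apply: continuous_min; [exact: cvg_cst|exact: cvg_id].
rewrite (_ : \int[mu]_(t in `[0, c]) _ =
    pi / 2 * \int[mu]_(t in `[0, c]) (f' t * Num.min s t)); last first.
  rewrite -RintegralZl //; last exact: continuous_segment_integrable.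
  apply: eq_Rintegral => t; rewrite inE /= in_itv /= => /andP[t0 _].
  by rewrite sine_kernel_integral // mulrCA.
rewrite mulrCA -mulrBr; congr (_ * _).
have i1 := continuous_segment_integrable 0 c cmin.
have splitE := Rintegral_itvB i1 (x := s).
rewrite !bnd_simp in splitE.
have {}splitE := splitE s0 s_c.
have E1 : \int[mu]_(t in `[0, s]) (f' t * Num.min s t) =
    s * f s - \int[mu]_(t in `[0, s]) f t.
  have ctf : continuous (fun t : R => t * f' t).
    by move=> t; apply: cvgM; [exact: cvg_id|exact: cf'].
  have cc : continuous (fun t : R => t * f' t + f t).
    by move=> t; apply: cvgD; [exact: ctf|exact: cf].
  have d (t : R) : is_derive t 1 (fun t => t * f t) (t * f' t + f t).
    apply: der_eq; first (apply: derM; [exact: der_id|exact: df]).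
    by rewrite /=; ring.
  have := Rintegral_FTC2 s0 d cc.
  rewrite mul0r subr0 RintegralD //; try exact: continuous_segment_integrable.
  move=> <-; rewrite addrK; apply: eq_Rintegral => t.
  by rewrite inE /= in_itv /= => /andP[_ ts]; rewrite min_r // mulrC.
have E2 : \int[mu]_(t in `]s, c]) (f' t * Num.min s t) = s * (f c - f s).
  transitivity (\int[mu]_(t in `]s, c]) (s * f' t)).
    apply: eq_Rintegral => t.
    by rewrite inE /= in_itv /= => /andP[/ltW st _]; rewrite min_l // mulrC.
  have i2 := continuous_segment_integrable s c cf'.
  have i3 : mu.-integrable `]s, c] (EFin \o f').
    by apply: integrableS i2 => //; apply: subset_itvr; rewrite bnd_simp.
  by rewrite RintegralZl // Rintegral_itv_obnd_cbnd // (Rintegral_FTC2 s_c df cf').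
rewrite -[\int[mu]_(t in `[0, c]) _](subrK
  (\int[mu]_(t in `[0, s]) (f' t * Num.min s t))).
by rewrite splitE E2 E1; ring.
Qed.

(** Duality with H the transform of f; the resulting expression is an
    integration by parts of f g, with the primitive of f vanishing at 0. *)
Lemma parseval_cosine_transform :
  mu.-integrable `]0, +oo[
    (EFin \o (fun x => cosine_transform c f x * cosine_transform c g x)) /\
  \int[mu]_(x in `]0, +oo[) (cosine_transform c f x * cosine_transform c g x)
  = pi / 2 * \int[mu]_(t in `[0, c]) (f t * g t).
Proof.
have [K K0 HK] := cosine_transform_decay df cf'.
have [iE E] := cosine_transform_duality (measurable_cosine_transform cf) K0 HK dg cg'.
split => //; rewrite E sine_kernel_cosine_transform; last by rewrite (ltW c0) /=.
pose Phi t := \int[mu]_(u in `[0, t]) f u.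
have i0 : mu.-integrable `[0, c] (EFin \o f) by exact: continuous_segment_integrable.
have cPhi : {within `[0, c], continuous Phi}.
  by have := parameterized_integral_continuous (ltW c0) i0.
have cgPhi : {within `[0, c], continuous (fun t => g' t * Phi t)}.
  move=> t; apply: cvgM; last exact: cPhi.
  by have := continuous_subspaceT cg' (A := `[0, c]); apply.
have iPhi : mu.-integrable `[0, c] (EFin \o (fun t => g' t * Phi t)).
  by apply: continuous_compact_integrable => //; exact: segment_compact.
rewrite [X in _ - X](_ : _ =
    pi / 2 * \int[mu]_(t in `[0, c]) (g' t * Phi t)); last first.
  rewrite -RintegralZl //.
  apply: eq_Rintegral => t; rewrite inE /= in_itv /= => tc.
  by rewrite sine_kernel_cosine_transform // mulrCA.
rewrite mulrCA -mulrBr; congr (_ * _).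
under [RHS]eq_Rintegral do rewrite mulrC.
have [dPhi dPhiE] : (forall t, t \in `]0, c[ -> derivable Phi t 1) /\
    {in `]0, c[, Phi^`()%classic =1 f}.
  by split=> t; rewrite in_itv /= => /andP[t0 tc];
    have [] := continuous_FTC1_closed tc i0 t0 (cf (x := t)).
have /(continuous_within_itvP _ c0)[_ Phi0 Phic] := cPhi.
rewrite (@Rintegration_by_parts _ g Phi g' f 0 c c0) //.
- by rewrite /Phi set_itv1 Rintegral_set1 mulr0 subr0.
- exact: continuous_subspaceT.
- split; first by move=> t _; have [] := dg t.
    by apply: cvg_at_right_filter; exact: cg.
  by apply: cvg_at_left_filter; exact: cg.
- by move=> t _; rewrite derive1E; have [_ ->] := dg t.
- exact: continuous_subspaceT.
Qed.

End Parseval.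
End Duality.

(** * Termwise integration and the integrals of cos ^ n t cos (x t) *)

Section TermwiseIntegration.
Context {R : realType}.
Notation mu := (@lebesgue_measure R).

(** Dominated convergence, the partial sums being bounded by the sum of the
    b k. *)
Lemma Rintegral_series (c : R) (u : nat -> R -> R) (f : R -> R) (b : nat -> R) :
  continuous f ->
  (forall k, continuous (u k)) ->
  (forall k t, 0 <= t <= c -> `|u k t| <= b k) -> (forall k, 0 <= b k) ->
  cvgn (series b) ->
  (forall t, 0 <= t <= c -> series (u^~ t) @ \oo --> f t) ->
  series (fun k => \int[mu]_(t in `[0, c]) u k t) @ \oo -->
  \int[mu]_(t in `[0, c]) f t.
Proof.
move=> cf cu ub b0 cb uf.
have cs n : continuous (fun t => series (u^~ t) n).
  elim: n => [|n IH] t.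
    by under eq_fun do rewrite /series /= big_geq //; exact: cvg_cst.
  under eq_fun do rewrite seriesSr.
  by apply: cvgD; [exact: IH|exact: cu].
have sle n t : 0 <= t <= c -> `|series (u^~ t) n| <= limn (series b).
  move=> tc; apply: (@le_trans _ _ (series b n)).
    rewrite /series /= (le_trans (ler_norm_sum _ _ _)) //.
    by apply: ler_sum => k _; exact: ub.
  by apply: nondecreasing_cvgn_le => //; exact: nondecreasing_series.
have Es n : (\int[mu]_(t in `[0%R, c]) (series (u^~ t) n)%:E =
    (series (fun k => \int[mu]_(t in `[0, c]) u k t) n)%:E)%E.
  rewrite -[LHS]fineK; last first.
    by apply: integrable_fin_num => //; exact: continuous_segment_integrable.
  congr EFin; rewrite -/(Rintegral mu `[0, c] (fun t => series (u^~ t) n)).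
  elim: n => [|n IH].
    rewrite [RHS]/series /= big_geq //.
    under eq_Rintegral do rewrite /series /= big_geq //.
    by rewrite Rintegral_cst // mul0r.
  rewrite seriesSr -IH.
  under eq_Rintegral do rewrite seriesSr.
  by rewrite RintegralD //; exact: continuous_segment_integrable.
have if0 := continuous_segment_integrable 0 c cf.
have H : (fun n => \int[mu]_(t in `[0%R, c]) (series (u^~ t) n)%:E)%E @ \oo -->
    (\int[mu]_(t in `[0%R, c]) (f t)%:E)%E.
  apply: (@dominated_cvg _ _ _ mu `[0, c] (measurable_itv _)
    (fun n t => (series (u^~ t) n)%:E) (fun t => (f t)%:E)
    (cst (limn (series b))%:E)) => //.
  - move=> n; apply/measurable_EFinP; apply: measurable_funTS.
    exact: continuous_measurable_fun.
  - move=> t /=; rewrite in_itv /= => tc; apply: cvg_EFin; last exact: uf.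
    exact: nearW.
  - by apply: continuous_segment_integrable => t; exact: cvg_cst.
move: H; rewrite (funext Es) -[X in _ --> X]fineK; last exact: integrable_fin_num.
exact: fine_cvg.
Qed.


(** Convergence is only known for the scaled series: when a = 0 the conclusion
    holds even if the series of u diverges, [limn] being total. *)
Lemma limn_seriesZ (a l : R) (u : nat -> R) :
  series (fun k => a * u k) @ \oo --> l -> a * limn (series u) = l.
Proof.
have E : series (fun k => a * u k) = (fun n => a * series u n).
  by apply/funext => n; rewrite /series /= mulr_sumr.
rewrite E => al; have [a0|a0] := eqVneq a 0.
  move: al; rewrite a0 mul0r; under eq_fun do rewrite mul0r.
  by move=> /(cvg_lim (@Rhausdorff R)); rewrite lim_cst.
have H : series u @ \oo --> a^-1 * l.
  rewrite (_ : series u = (fun n => a^-1 * (a * series u n))); last first.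
    by apply/funext => n; rewrite mulKf.
  by apply: cvgM; [exact: cvg_cst|].
by rewrite (cvg_lim (@Rhausdorff R) H) mulVKf.
Qed.

(** For y = z ^ 2, dominates the terms of order 2 k, and up to a factor |z|
    those of order 2 k + 1, of the exponential series of |z|. *)
Lemma exp_coeff_bound (y : R) (k m : nat) : 0 <= y -> (k <= m)%N ->
  y ^+ k / m`!%:R <= exp_coeff y k.
Proof.
move=> y0 km; rewrite /exp_coeff /= ler_wpM2l ?exprn_ge0 //.
by rewrite lef_pV2 ?posrE ?ltr0n ?fact_gt0 // ler_nat leq_fact.
Qed.

End TermwiseIntegration.

Section CosinePowers.
Context {R : realType}.
Notation mu := (@lebesgue_measure R).
Notation cosT := (@cosine_transform R (pi / 2)).

Lemma pihalf_gt0 : 0 < pi / 2 :> R.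
Proof. by rewrite divr_gt0 // pi_gt0. Qed.

Definition cosine_power (n : nat) (x : R) : R := cosT (fun t => cos t ^+ n) x.

Lemma continuous_cosX (n : nat) : continuous (fun t : R => cos t ^+ n).
Proof.
apply: (is_derive_continuous (f := fun t => n%:R * cos t ^+ n.-1 * (- sin t * 1))).
by move=> t; derive_tac.
Qed.

Lemma continuous_cosXM (n : nat) (x : R) :
  continuous (fun t : R => cos t ^+ n * cos (x * t)).
Proof.
by move=> t; apply: cvgM; [exact: continuous_cosX|exact: continuous_cos_scale].
Qed.

(** With u = cos ^ (n + 2) and v = cos (x t), the Wronskian W = u' v - u v' has
    derivative u'' v - u v'', where v'' = - x ^ 2 v and u'' is a combination of
    cos ^ n and cos ^ (n + 2); W vanishes at both ends of [0, pi / 2]. *)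
Lemma cosine_power_rec (n : nat) (x : R) :
  (n.+2%:R ^+ 2 - x ^+ 2) * cosine_power n.+2 x =
  n.+2%:R * n.+1%:R * cosine_power n x.
Proof.
pose W (t : R) := n.+2%:R * cos t ^+ n.+1 * - sin t * cos (x * t)
  + cos t ^+ n.+2 * (x * sin (x * t)).
have dW (t : R) : is_derive t 1 W
   (n.+2%:R * n.+1%:R * (cos t ^+ n * cos (x * t))
    - (n.+2%:R ^+ 2 - x ^+ 2) * (cos t ^+ n.+2 * cos (x * t))).
  (* the relation sin ^ 2 + cos ^ 2 = 1, entered as a multiple of 0 so that the
     identity becomes polynomial *)
  have S0 : sin t ^+ 2 + cos t ^+ 2 - 1 = 0 by rewrite sin2cos2; ring.
  rewrite /W; derive_tac; rewrite -[RHS]addr0.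
  rewrite -[X in _ = _ + X](mulr0 (n.+2%:R * n.+1%:R * cos t ^+ n * cos (x * t))).
  rewrite -[X in _ = _ + _ * X]S0.
  by rewrite !exprS; ring.
have i1 := continuous_segment_integrable 0 (pi / 2) (@continuous_cosXM n x).
have i2 := continuous_segment_integrable 0 (pi / 2) (@continuous_cosXM n.+2 x).
have cW : continuous (fun t : R => n.+2%:R * n.+1%:R * (cos t ^+ n * cos (x * t))
    - (n.+2%:R ^+ 2 - x ^+ 2) * (cos t ^+ n.+2 * cos (x * t))).
  by move=> t; apply: cvgB; apply: cvgM; try exact: cvg_cst; exact: continuous_cosXM.
have := Rintegral_FTC2 (ltW pihalf_gt0) dW cW.
rewrite RintegralB //; [|by have := integrableZl _ _ i1; apply
  |by have := integrableZl _ _ i2; apply].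
rewrite !RintegralZl // /W cos_pihalf mulr0 sin0 !expr0n /= !(mul0r,mulr0,oppr0,addr0).
by move=> /eqP; rewrite subr_eq0 => /eqP <-.
Qed.

Lemma cosine_power0 (x : R) : x != 0 -> cosine_power 0 x = sin (pi * x / 2) / x.
Proof.
move=> x0.
have d (t : R) : is_derive t 1 (fun t => sin (x * t) / x) (cos t ^+ 0 * cos (x * t)).
  by derive_tac; rewrite expr0; field.
rewrite /cosine_power /cosine_transform.
rewrite (Rintegral_FTC2 (ltW pihalf_gt0) d (@continuous_cosXM 0 x)).
by rewrite mulr0 sin0 mul0r subr0 (_ : x * (pi / 2) = pi * x / 2) //; ring.
Qed.

Lemma cosine_power00 : cosine_power 0 (0 : R) = pi / 2.
Proof.
rewrite /cosine_power /cosine_transform.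
under eq_Rintegral do rewrite expr0 mul0r cos0 mulr1.
rewrite Rintegral_cst //= lebesgue_measure_itv /= lte_fin pihalf_gt0 oppr0 addr0.
by rewrite /= mul1r.
Qed.

Lemma cosine_power1 (x : R) : (1 - x ^+ 2) * cosine_power 1 x = cos (pi * x / 2).
Proof.
have d (t : R) : is_derive t 1 (fun t => sin t * cos (x * t) - cos t * (x * sin (x * t)))
    ((1 - x ^+ 2) * (cos t ^+ 1 * cos (x * t))).
  by derive_tac; rewrite expr1; ring.
have cc : continuous (fun t : R => (1 - x ^+ 2) * (cos t ^+ 1 * cos (x * t))).
  by move=> t; apply: cvgM; [exact: cvg_cst|exact: continuous_cosXM].
have := Rintegral_FTC2 (ltW pihalf_gt0) d cc.
have i1 := continuous_segment_integrable 0 (pi / 2) (@continuous_cosXM 1 x).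
rewrite RintegralZl //.
rewrite /cosine_power /cosine_transform => ->.
rewrite sin_pihalf cos_pihalf sin0 !mulr0 sin0 !(mul0r, mulr0, subr0) mul1r.
by congr cos; ring.
Qed.

Lemma is_derive_sinZcos (z : R) (t : R) :
  is_derive t 1 (fun t => sin (z * cos t)) (- z * sin t * cos (z * cos t)).
Proof. by derive_tac; ring. Qed.

Lemma is_derive_cosZcos (z : R) (t : R) :
  is_derive t 1 (fun t => cos (z * cos t)) (z * sin t * sin (z * cos t)).
Proof. by derive_tac; ring. Qed.

Lemma continuous_sinZcos (z : R) : continuous (fun t : R => sin (z * cos t)).
Proof. exact: (is_derive_continuous (is_derive_sinZcos z)). Qed.

Lemma continuous_cosZcos (z : R) : continuous (fun t : R => cos (z * cos t)).
Proof. exact: (is_derive_continuous (is_derive_cosZcos z)). Qed.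

Lemma continuous_derive_sinZcos (z : R) :
  continuous (fun t : R => - z * sin t * cos (z * cos t)).
Proof.
move=> t; apply: cvgM; last exact: continuous_cosZcos.
by apply: cvgM; [exact: cvg_cst|exact: continuous_sin].
Qed.

Lemma continuous_derive_cosZcos (z : R) :
  continuous (fun t : R => z * sin t * sin (z * cos t)).
Proof.
move=> t; apply: cvgM; last exact: continuous_sinZcos.
by apply: cvgM; [exact: cvg_cst|exact: continuous_sin].
Qed.

Lemma series_cosine_transform_sin (z x : R) :
  series (fun k => (-1) ^+ k * z ^+ k.*2.+1 / k.*2.+1`!%:R * cosine_power k.*2.+1 x)
  @ \oo --> cosT (fun t => sin (z * cos t)) x.
Proof.
pose u k (t : R) :=
  (-1) ^+ k * z ^+ k.*2.+1 / k.*2.+1`!%:R * (cos t ^+ k.*2.+1 * cos (x * t)).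
rewrite (_ : (fun k => _) = (fun k => \int[mu]_(t in `[0, pi / 2]) u k t)); last first.
  apply/funext => k; rewrite /u RintegralZl //.
  exact: (continuous_segment_integrable 0 (pi / 2) (@continuous_cosXM k.*2.+1 x)).
apply: (Rintegral_series (b := fun k => `|z| * exp_coeff (z ^+ 2) k)).
- move=> t; apply: cvgM; last exact: continuous_cos_scale.
  exact: continuous_sinZcos.
- by move=> k t; apply: cvgM; [exact: cvg_cst|exact: continuous_cosXM].
- move=> k t _; rewrite /u !normrM normrX normrN1 expr1n mul1r !normrX normfV normr_nat.
  apply: (@le_trans _ _ (`|z| ^+ k.*2.+1 / k.*2.+1`!%:R * 1)).
    rewrite ler_wpM2l // ?divr_ge0 ?exprn_ge0 //.
    by rewrite mulr_ile1 ?exprn_ge0 ?exprn_ile1 ?cos_max.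
  rewrite mulr1 exprS -mulrA ler_wpM2l //.
  rewrite -muln2 mulnC exprM real_normK ?num_real //.
  apply: exp_coeff_bound; rewrite ?sqr_ge0 //.
  by rewrite mul2n -addnn ltnW // ltnS leq_addr.
- by move=> k; rewrite mulr_ge0 // /exp_coeff /= divr_ge0 // exprn_ge0 // sqr_ge0.
- exact: (is_cvg_seriesZ (k := `|z|) (is_cvg_series_exp_coeff (z ^+ 2))).
- move=> t _.
  rewrite (_ : series _ = (fun n => series (sin_coeff' (z * cos t)) n * cos (x * t))).
    by apply: cvgM; [exact: cvg_sin_coeff'|exact: cvg_cst].
  apply/funext => n; rewrite /series /= mulr_suml; apply: eq_bigr => k _.
  by rewrite /u /sin_coeff' -exprnP exprMn; ring.
Qed.

Lemma series_cosine_transform_cos (z x : R) :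
  series (fun k => (-1) ^+ k * z ^+ k.*2 / k.*2`!%:R * cosine_power k.*2 x)
  @ \oo --> cosT (fun t => cos (z * cos t)) x.
Proof.
pose u k (t : R) :=
  (-1) ^+ k * z ^+ k.*2 / k.*2`!%:R * (cos t ^+ k.*2 * cos (x * t)).
rewrite (_ : (fun k => _) = (fun k => \int[mu]_(t in `[0, pi / 2]) u k t)); last first.
  apply/funext => k; rewrite /u RintegralZl //.
  exact: (continuous_segment_integrable 0 (pi / 2) (@continuous_cosXM k.*2 x)).
apply: (Rintegral_series (b := exp_coeff (z ^+ 2))).
- move=> t; apply: cvgM; last exact: continuous_cos_scale.
  exact: continuous_cosZcos.
- by move=> k t; apply: cvgM; [exact: cvg_cst|exact: continuous_cosXM].
- move=> k t _; rewrite /u !normrM normrX normrN1 expr1n mul1r !normrX normfV normr_nat.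
  apply: (@le_trans _ _ (`|z| ^+ k.*2 / k.*2`!%:R * 1)).
    rewrite ler_wpM2l // ?divr_ge0 ?exprn_ge0 //.
    by rewrite mulr_ile1 ?exprn_ge0 ?exprn_ile1 ?cos_max.
  rewrite mulr1 -muln2 mulnC exprM real_normK ?num_real //.
  apply: exp_coeff_bound; rewrite ?sqr_ge0 //.
  by rewrite mul2n -addnn leq_addr.
- by move=> k; rewrite /exp_coeff /= divr_ge0 // exprn_ge0 // sqr_ge0.
- exact: is_cvg_series_exp_coeff.
- move=> t _.
  rewrite (_ : series _ = (fun n => series (cos_coeff' (z * cos t)) n * cos (x * t))).
    by apply: cvgM; [exact: cvg_cos_coeff'|exact: cvg_cst].
  apply/funext => n; rewrite /series /= mulr_suml; apply: eq_bigr => k _.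
  by rewrite /u /cos_coeff' -exprnP exprMn; ring.
Qed.

End CosinePowers.

(** * Lommel, Bessel and Struve functions as integrals over a quarter period *)

Section Representations.
Context {R : realType}.
Notation mu := (@lebesgue_measure R).
Notation cosT := (@cosine_transform R (pi / 2)).

Lemma pochhammerS (a : R) (k : nat) :
  pochhammer a k.+1 = pochhammer a k * (a + k%:R).
Proof. by rewrite /pochhammer big_ord_recr. Qed.

Lemma pochhammer0 (a : R) : pochhammer a 0 = 1.
Proof. by rewrite /pochhammer big_ord0. Qed.

(** The summand of [hyp1F2] at numerator parameter 1. *)
Definition hyp1F2_term (b c w : R) (k : nat) : R :=
  pochhammer 1 k / (pochhammer b k * pochhammer c k) * (w ^+ k / k`!%:R).

Lemma hyp1F2E (b c w : R) :
  hyp1F2 1 b c w = limn (series (hyp1F2_term b c w)).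
Proof. by []. Qed.

Lemma hyp1F2_term_0 (b c w : R) : hyp1F2_term b c w 0 = 1.
Proof. by rewrite /hyp1F2_term !pochhammer0 expr0 fact0 !(mulr1, invr1). Qed.

(** The numerator (1)_k cancels k!. *)
Lemma hyp1F2_termS (b c w : R) (k : nat) : hyp1F2_term b c w k.+1 =
  hyp1F2_term b c w k * (w / ((b + k%:R) * (c + k%:R))).
Proof.
have k1 : (1 + k%:R) * k.+1%:R^-1 = 1 :> R.
  by rewrite addrC natr1 mulfV // pnatr_eq0.
rewrite /hyp1F2_term !pochhammerS factS natrM exprS !invfM.
rewrite -[RHS]mulr1 -[X in _ = _ * X]k1; ring.
Qed.

Lemma odd_denominator_neq0 (x : R) (k : nat) : 0 <= x ->
  (forall n : nat, x != n.*2.+1%:R) -> k.*2.+1%:R ^+ 2 - x ^+ 2 != 0.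
Proof.
move=> x0 xodd; rewrite subr_eq0 eqf_sqr negb_or eq_sym xodd /=.
apply/eqP => E; have : 0 < k.*2.+1%:R :> R by rewrite ltr0n.
by rewrite E oppr_gt0 ltNge x0.
Qed.

Lemma even_denominator_neq0 (x : R) (k : nat) : 0 <= x ->
  (forall n : nat, x != n.*2%:R) -> k.*2%:R ^+ 2 - x ^+ 2 != 0.
Proof.
move=> x0 xeven; rewrite subr_eq0 eqf_sqr negb_or eq_sym xeven /=.
apply/eqP => E; have : 0 <= k.*2%:R :> R by [].
rewrite E oppr_ge0 => x0'.
by have /eqP := xeven 0%N; apply; apply/eqP; rewrite eq_le x0 x0'.
Qed.

(** Termwise: the k-th term of the hypergeometric series, multiplied by the
    prefactor, is the k-th term of the expansion of sin (z cos t) integrated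
    against cos (x t), because both obey the same recurrence in k. *)
Lemma lommel0_cosine_transform (x z : R) : 0 <= x ->
  (forall n : nat, x != n.*2.+1%:R) ->
  cos (pi * x / 2) * lommel 0 x z = cosT (fun t => sin (z * cos t)) x.
Proof.
move=> x0 xodd.
pose a := cos (pi * x / 2) * (z / (1 - x ^+ 2)).
pose u := hyp1F2_term ((0 - x + 3) / 2) ((0 + x + 3) / 2) (- (z ^+ 2 / 4)).
suff H : series (fun k => a * u k) @ \oo --> cosT (fun t => sin (z * cos t)) x.
  rewrite -(limn_seriesZ H) /a /lommel mulr0z hyp1F2E -/u.
  by rewrite !add0r expr1n expr1z !mulrA.
rewrite (_ : (fun k => a * u k) = (fun k =>
  (-1) ^+ k * z ^+ k.*2.+1 / k.*2.+1`!%:R * cosine_power k.*2.+1 x)).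
  exact: series_cosine_transform_sin.
apply/funext; elim=> [|k IH].
  have := odd_denominator_neq0 0 x0 xodd; rewrite expr1n => d0.
  rewrite /u hyp1F2_term_0 /a -cosine_power1 expr0 expr1.
  rewrite (_ : (0.*2.+1)`! = 1%N) //; field.
  exact: d0.
rewrite /u hyp1F2_termS mulrA -/u IH.
have d0 := odd_denominator_neq0 k.+1 x0 xodd.
have -> : (((0 - x + 3) / 2 + k%:R) * ((0 + x + 3) / 2 + k%:R))
   = (k.+1.*2.+1%:R ^+ 2 - x ^+ 2) / 4 :> R.
  by rewrite doubleS -!natr1 -muln2 natrM; field.
have -> : cosine_power k.+1.*2.+1 x = k.+1.*2.+1%:R * k.+1.*2%:R
    * cosine_power k.*2.+1 x / (k.+1.*2.+1%:R ^+ 2 - x ^+ 2).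
  apply: (mulfI d0); rewrite [RHS]mulrC mulfVK //.
  exact: cosine_power_rec.
rewrite doubleS !factS !natrM !exprS.
have f0 : (k.*2)`!%:R != 0 :> R by rewrite pnatr_eq0 -lt0n fact_gt0.
have f1 : k.*2.+1%:R != 0 :> R by rewrite pnatr_eq0.
have f2 : k.*2.+2%:R != 0 :> R by rewrite pnatr_eq0.
have f3 : k.*2.+3%:R != 0 :> R by rewrite pnatr_eq0.
rewrite doubleS !expr2 in d0.
move: d0 f0 f1 f2 f3; rewrite !expr0.
move: (k.*2.+3%:R : R) (k.*2.+2%:R : R) (k.*2.+1%:R : R) ((k.*2)`!%:R : R).
by move=> A B C D d0 f0 f1 f2 f3; field; rewrite d0 f0 f1 f2 f3.
Qed.

(** The even counterpart, from the expansion of cos (z cos t). *)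
Lemma lommelN1_cosine_transform (x z : R) : 0 <= x ->
  (forall n : nat, x != n.*2%:R) ->
  - (x * sin (pi * x / 2) * lommel (-1) x z) = cosT (fun t => cos (z * cos t)) x.
Proof.
move=> x0 xeven.
pose a := x * sin (pi * x / 2) / x ^+ 2.
pose u := hyp1F2_term (((-1) - x + 3) / 2) (((-1) + x + 3) / 2) (- (z ^+ 2 / 4)).
have xn0 : x != 0 by exact: xeven 0%N.
suff H : series (fun k => a * u k) @ \oo --> cosT (fun t => cos (z * cos t)) x.
  rewrite -(limn_seriesZ H) /a /lommel (_ : (-1)%:~R = -1 :> R) // hyp1F2E -/u.
  rewrite !addNr expr0n expr0z.
  by rewrite sub0r invrN !mul1r mulNr mulrN opprK mulrA.
rewrite (_ : (fun k => a * u k) = (fun k =>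
  (-1) ^+ k * z ^+ k.*2 / k.*2`!%:R * cosine_power k.*2 x)).
  exact: series_cosine_transform_cos.
apply/funext; elim=> [|k IH].
  by rewrite /u hyp1F2_term_0 /a cosine_power0 // !expr0 (_ : (0.*2)`! = 1%N) //; field.
rewrite /u hyp1F2_termS mulrA -/u IH.
have d0 := even_denominator_neq0 k.+1 x0 xeven.
have -> : ((((-1) - x + 3) / 2 + k%:R) * (((-1) + x + 3) / 2 + k%:R))
   = (k.+1.*2%:R ^+ 2 - x ^+ 2) / 4 :> R.
  by rewrite doubleS -!natr1 -muln2 natrM; field.
have -> : cosine_power k.+1.*2 x = k.+1.*2%:R * k.*2.+1%:R
    * cosine_power k.*2 x / (k.+1.*2%:R ^+ 2 - x ^+ 2).
  apply: (mulfI d0); rewrite [RHS]mulrC mulfVK //.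
  exact: cosine_power_rec.
rewrite doubleS !factS !natrM !exprS.
have f0 : (k.*2)`!%:R != 0 :> R by rewrite pnatr_eq0 -lt0n fact_gt0.
have f1 : k.*2.+1%:R != 0 :> R by rewrite pnatr_eq0.
have f2 : k.*2.+2%:R != 0 :> R by rewrite pnatr_eq0.
rewrite doubleS !expr2 in d0.
move: d0 f0 f1 f2; rewrite !expr0.
move: (k.*2.+2%:R : R) (k.*2.+1%:R : R) ((k.*2)`!%:R : R).
by move=> A B C d0 f0 f1 f2; field; rewrite d0 f0 f1 f2.
Qed.

(** The same expansion of cos (z cos t), now at x = 0, where the integrals of
    the even powers of the cosine are the Wallis integrals. *)
Lemma besselJ0_integral (z : R) :
  \int[mu]_(t in `[0, pi / 2]) cos (z * cos t) = pi / 2 * besselJ0 z.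
Proof.
transitivity (cosT (fun t => cos (z * cos t)) 0).
  by apply: eq_Rintegral => t _; rewrite mul0r cos0 mulr1.
apply/esym; apply: limn_seriesZ.
rewrite (_ : (fun k => _) = (fun k =>
  (-1) ^+ k * z ^+ k.*2 / k.*2`!%:R * cosine_power k.*2 0)).
  exact: series_cosine_transform_cos.
apply/funext; elim=> [|k IH].
  by rewrite cosine_power00 !expr0 fact0; field.
have f0 : (k.*2)`!%:R != 0 :> R by rewrite pnatr_eq0 -lt0n fact_gt0.
have f1 : k.*2.+1%:R != 0 :> R by rewrite pnatr_eq0.
have f2 : k.+1%:R != 0 :> R by rewrite pnatr_eq0.
have f3 : k`!%:R != 0 :> R by rewrite pnatr_eq0 -lt0n fact_gt0.
have E2 : k.*2.+2%:R = 2 * k.+1%:R :> R by rewrite -doubleS -muln2 natrM mulrC.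
have -> : cosine_power k.+1.*2 0 = k.*2.+1%:R * cosine_power k.*2 0 / (2 * k.+1%:R) :> R.
  have := cosine_power_rec k.*2 (0 : R); rewrite expr0n subr0 doubleS E2 => E.
  apply: (mulfI (x := (2 * k.+1%:R) ^+ 2)); first by rewrite expf_neq0 // mulf_neq0.
  rewrite E; move: f2; move: (k.+1%:R : R) (k.*2.+1%:R : R) => A B f2.
  by field; rewrite f2.
transitivity (pi / 2 * ((-1) ^+ k / k`!%:R ^+ 2 * (z / 2) ^+ k.*2)
   * (- (z / 2) ^+ 2 / k.+1%:R ^+ 2)).
  rewrite doubleS !factS !natrM !exprS; move: f2 f3.
  move: (k.+1%:R : R) (k`!%:R : R) => A B f2 f3; field; by rewrite f2 f3.
rewrite IH doubleS !factS !natrM !exprS E2; move: f0 f1 f2.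
move: (k.+1%:R : R) (k.*2.+1%:R : R) ((k.*2)`!%:R : R) => A B C f0 f1 f2.
by field; rewrite f0 f1 f2.
Qed.

Lemma struveH0_integral (z : R) :
  \int[mu]_(t in `[0, pi / 2]) sin (z * cos t) = pi / 2 * struveH0 z.
Proof.
have p0 : pi / 2 != 0 :> R by rewrite gt_eqF // pihalf_gt0.
by rewrite /struveH0 mulrA -[2 / pi]invf_div mulfV // mul1r.
Qed.

Lemma besselJ0_norm (z : R) : besselJ0 `|z| = besselJ0 z.
Proof.
congr (limn (series _)); apply/funext => k.
by rewrite -muln2 mulnC !exprM !expr_div_n real_normK // num_real.
Qed.

End Representations.

(** * The integrals over the index *)

Section NullSets.
Context {R : realType}.
Notation mu := (@lebesgue_measure R).

Lemma countable_integer_points (N : set R) :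
  N `<=` even_points `|` odd_points -> countable N.
Proof.
move=> NZ; apply: (card_le_trans (subset_card_le _)
  (card_image_le (fun n : nat => n%:R : R) setT)).
by move=> x /NZ [] [n ->]; eexists.
Qed.

(** The excluded integers form a null set, so it is enough to know the
    integrand off them. *)
Lemma has_integral_off_countable (N : set R) (h F : R -> R) (v : R) :
  countable N -> measurable_fun setT F ->
  mu.-integrable `]0, +oo[ (EFin \o F) ->
  \int[mu]_(x in `]0, +oo[) F x = v ->
  (forall x, 0 <= x -> ~ N x -> h x = F x) ->
  has_integral (`[0, +oo[ `\` N) h v.
Proof.
move=> cN mF iF <- hF.
have mN : measurable N by exact: countable_measurable.
have N0 : mu N = 0 by exact: countable_lebesgue_measure0.
have mD : measurable (`[0, +oo[ `\` N : set R) by exact: measurableD.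
have mFE (D : set R) : measurable_fun D (EFin \o F).
  by apply/measurable_EFinP; exact: measurable_funTS.
have i0 : mu.-integrable `[0, +oo[ (EFin \o F).
  apply: (proj2 (@negligible_integrable _ _ _ mu `[0, +oo[ [set 0] _
    (measurable_set1 0) (measurable_itv _) (mFE _) (lebesgue_measure_set1 0))).
  by rewrite setDitv1l.
have iD : mu.-integrable (`[0, +oo[ `\` N) (EFin \o F).
  exact: (proj1 (@negligible_integrable _ _ _ mu `[0, +oo[ N _
    mN (measurable_itv _) (mFE _) N0)).
have hFD : {in `[0, +oo[ `\` N, h =1 F}.
  by move=> x; rewrite inE => -[/=]; rewrite in_itv /= andbT; exact: hF.
split.
  by apply: eq_integrable iD => // x xD /=; rewrite hFD.
transitivity (\int[mu]_(x in `[0, +oo[ `\` N) F x); first exact: eq_Rintegral.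
rewrite Rintegral_itv_obnd_cbnd //.
by congr fine; rewrite -(@negligible_integral _ _ _ mu `[0, +oo[ N).
Qed.

End NullSets.

Section Integrals.
Context {R : realType}.
Notation mu := (@lebesgue_measure R).
Notation c := (pi / 2 : R).
Notation FS a := (cosine_transform c (fun t => sin (a * cos t))).
Notation FC a := (cosine_transform c (fun t => cos (a * cos t))).

Lemma measurable_FS (a : R) : measurable_fun setT (FS a).
Proof. by apply: measurable_cosine_transform; exact: continuous_sinZcos. Qed.

Lemma measurable_FC (a : R) : measurable_fun setT (FC a).
Proof. by apply: measurable_cosine_transform; exact: continuous_cosZcos. Qed.

Lemma integral_FC_FS (a b : R) :
  mu.-integrable `]0, +oo[ (EFin \o (fun x => FC a x * FS b x)) /\
  \int[mu]_(x in `]0, +oo[) (FC a x * FS b x) =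
  pi ^+ 2 / 8 * (struveH0 (a + b) - struveH0 (a - b)).
Proof.
have [iE E] := parseval_cosine_transform (@pihalf_gt0 R)
  (is_derive_cosZcos a) (@continuous_derive_cosZcos R a)
  (is_derive_sinZcos b) (@continuous_derive_sinZcos R b).
split => //; rewrite E.
have i1 := continuous_segment_integrable 0 c (@continuous_sinZcos R (a + b)).
have i2 := continuous_segment_integrable 0 c (@continuous_sinZcos R (a - b)).
rewrite (_ : \int[mu]_(t in `[0, c]) _ = \int[mu]_(t in `[0, c])
    (2^-1 * (sin ((a + b) * cos t) - sin ((a - b) * cos t)))); last first.
  apply: eq_Rintegral => t _; rewrite [(a + b) * _]mulrDl [(a - b) * _]mulrBl.
  by rewrite sinB sinD; field.
rewrite RintegralZl //; last by have := integrableB _ i1 i2; apply.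
rewrite RintegralB // !struveH0_integral; move: (pi : R) => p; by field.
Qed.

Lemma integral_FS_FS (a b : R) :
  mu.-integrable `]0, +oo[ (EFin \o (fun x => FS a x * FS b x)) /\
  \int[mu]_(x in `]0, +oo[) (FS a x * FS b x) =
  pi ^+ 2 / 8 * (besselJ0 (a - b) - besselJ0 (a + b)).
Proof.
have [iE E] := parseval_cosine_transform (@pihalf_gt0 R)
  (is_derive_sinZcos a) (@continuous_derive_sinZcos R a)
  (is_derive_sinZcos b) (@continuous_derive_sinZcos R b).
split => //; rewrite E.
have i1 := continuous_segment_integrable 0 c (@continuous_cosZcos R (a - b)).
have i2 := continuous_segment_integrable 0 c (@continuous_cosZcos R (a + b)).
rewrite (_ : \int[mu]_(t in `[0, c]) _ = \int[mu]_(t in `[0, c])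
    (2^-1 * (cos ((a - b) * cos t) - cos ((a + b) * cos t)))); last first.
  apply: eq_Rintegral => t _; rewrite [(a + b) * _]mulrDl [(a - b) * _]mulrBl.
  by rewrite cosB cosD; field.
rewrite RintegralZl //; last by have := integrableB _ i1 i2; apply.
rewrite RintegralB // !besselJ0_integral; move: (pi : R) => p; by field.
Qed.

Lemma integral_FC_FC (a b : R) :
  mu.-integrable `]0, +oo[ (EFin \o (fun x => FC a x * FC b x)) /\
  \int[mu]_(x in `]0, +oo[) (FC a x * FC b x) =
  pi ^+ 2 / 8 * (besselJ0 (a - b) + besselJ0 (a + b)).
Proof.
have [iE E] := parseval_cosine_transform (@pihalf_gt0 R)
  (is_derive_cosZcos a) (@continuous_derive_cosZcos R a)
  (is_derive_cosZcos b) (@continuous_derive_cosZcos R b).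
split => //; rewrite E.
have i1 := continuous_segment_integrable 0 c (@continuous_cosZcos R (a - b)).
have i2 := continuous_segment_integrable 0 c (@continuous_cosZcos R (a + b)).
rewrite (_ : \int[mu]_(t in `[0, c]) _ = \int[mu]_(t in `[0, c])
    (2^-1 * (cos ((a - b) * cos t) + cos ((a + b) * cos t)))); last first.
  apply: eq_Rintegral => t _; rewrite [(a + b) * _]mulrDl [(a - b) * _]mulrBl.
  by rewrite cosB cosD; field.
rewrite RintegralZl //; last by have := integrableD _ i1 i2; apply.
rewrite RintegralD // !besselJ0_integral; move: (pi : R) => p; by field.
Qed.

Lemma lommel0_FS (a x : R) : 0 <= x -> ~ odd_points x ->
  cos (pi * x / 2) * lommel 0 x a = FS a x.
Proof.
move=> x0 xodd; apply: lommel0_cosine_transform => // n.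
by apply/eqP => xn; apply: xodd; exists n.
Qed.

Lemma lommelN1_FC (a x : R) : 0 <= x -> ~ even_points x ->
  x * sin (pi * x / 2) * lommel (-1) x a = - FC a x.
Proof.
move=> x0 xeven; rewrite -lommelN1_cosine_transform ?opprK // => n.
by apply/eqP => xn; apply: xeven; exists n.
Qed.

(** x sin (pi x) = 2 x sin (pi x / 2) cos (pi x / 2), hence the factor - 2. *)
Lemma has_integral_lommelN1_lommel0 (a b : R) :
  has_integral (`[0, +oo[ `\` (even_points `|` odd_points))
    (fun x => x * sin (pi * x) * lommel (-1) x a * lommel 0 x b)
    (pi ^+ 2 / 4 * (struveH0 (a - b) - struveH0 (a + b))).
Proof.
have [iE E] := integral_FC_FS a b.
apply: (has_integral_off_countable (F := fun x => - 2 * (FC a x * FS b x))).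
- exact: countable_integer_points.
- apply: measurable_funM => //.
  by apply: measurable_funM; [exact: measurable_FC|exact: measurable_FS].
- by have := integrableZl _ (- 2) iE; apply.
- by rewrite RintegralZl // E; move: (pi : R) => p; by field.
- move=> x x0 xN.
  have xe : ~ even_points x by move=> xe; apply: xN; left.
  have xo : ~ odd_points x by move=> xo; apply: xN; right.
  have -> : sin (pi * x) = 2 * sin (pi * x / 2) * cos (pi * x / 2).
    have {1}-> : pi * x = pi * x / 2 + pi * x / 2 by rewrite -splitr.
    by rewrite sinD; ring.
  rewrite -(lommel0_FS b x0 xo) -[FC a x]opprK -(lommelN1_FC a x0 xe); ring.
Qed.

Lemma has_integral_lommel0_lommel0 (a b : R) :
  has_integral (`[0, +oo[ `\` odd_points)
    (fun x => cos (pi * x / 2) ^+ 2 * lommel 0 x a * lommel 0 x b)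
    (pi ^+ 2 / 8 * (besselJ0 (a - b) - besselJ0 (a + b))).
Proof.
have [iE E] := integral_FS_FS a b.
apply: (has_integral_off_countable (F := fun x => FS a x * FS b x)) => //.
- by apply: countable_integer_points => x ?; right.
- by apply: measurable_funM; exact: measurable_FS.
- move=> x x0 xo; rewrite -!lommel0_FS //; ring.
Qed.

Lemma has_integral_lommelN1_lommelN1 (a b : R) :
  has_integral (`[0, +oo[ `\` even_points)
    (fun x => x ^+ 2 * sin (pi * x / 2) ^+ 2 * lommel (-1) x a * lommel (-1) x b)
    (pi ^+ 2 / 8 * (besselJ0 (a - b) + besselJ0 (a + b))).
Proof.
have [iE E] := integral_FC_FC a b.
apply: (has_integral_off_countable (F := fun x => FC a x * FC b x)) => //.
- by apply: countable_integer_points => x ?; left.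
- by apply: measurable_funM; exact: measurable_FC.
- move=> x x0 xe; rewrite -[RHS]mulrNN -!lommelN1_FC //; ring.
Qed.

End Integrals.

Lemma struveH0_0 (R : realType) : struveH0 (0 : R) = 0.
Proof.
rewrite /struveH0; under eq_Rintegral do rewrite mul0r sin0.
by rewrite Rintegral_cst // mul0r mulr0.
Qed.

Lemma besselJ0_0 (R : realType) : besselJ0 (0 : R) = 1.
Proof.
have p0 : pi / 2 != 0 :> R by rewrite gt_eqF // pihalf_gt0.
apply: (mulfI p0); rewrite -besselJ0_integral.
under eq_Rintegral do rewrite mul0r cos0.
by rewrite Rintegral_cst //= lebesgue_measure_itv /= lte_fin pihalf_gt0 oppr0 addr0
  /= mul1r mulr1.
Qed.

Theorem theorem1 (R : realType) (a b : R) :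
  [/\ has_integral (`[0, +oo[ `\` (even_points `|` odd_points))
        (fun x => x * sin (pi * x) * lommel (-1) x a * lommel 0 x b)
        (pi ^+ 2 / 4 * (struveH0 (a - b) - struveH0 (a + b))),
      has_integral (`[0, +oo[ `\` (even_points `|` odd_points))
        (fun x => x * sin (pi * x) * lommel (-1) x a * lommel 0 x a)
        (- (pi ^+ 2 / 4) * struveH0 (2 * a)) &
      [/\ has_integral (`[0, +oo[ `\` odd_points)
            (fun x => cos (pi * x / 2) ^+ 2 * lommel 0 x a * lommel 0 x b)
            (pi ^+ 2 / 8 * (besselJ0 `|a - b| - besselJ0 (a + b))),
          has_integral (`[0, +oo[ `\` odd_points)
            (fun x => cos (pi * x / 2) ^+ 2 * lommel 0 x a ^+ 2)
            (pi ^+ 2 / 8 * (1 - besselJ0 (2 * a))),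
          has_integral (`[0, +oo[ `\` even_points)
            (fun x => x ^+ 2 * sin (pi * x / 2) ^+ 2 *
                      lommel (-1) x a * lommel (-1) x b)
            (pi ^+ 2 / 8 * (besselJ0 `|a - b| + besselJ0 (a + b))) &
          has_integral (`[0, +oo[ `\` even_points)
            (fun x => x ^+ 2 * sin (pi * x / 2) ^+ 2 * lommel (-1) x a ^+ 2)
            (pi ^+ 2 / 8 * (1 + besselJ0 (2 * a)))]].
Proof.
have a2 : 2 * a = a + a by rewrite mulr_natl mulr2n.
rewrite besselJ0_norm a2.
split; [exact: has_integral_lommelN1_lommel0| |split].
- have := has_integral_lommelN1_lommel0 a a.
  by rewrite subrr struveH0_0 sub0r mulrN mulNr.
- exact: has_integral_lommel0_lommel0.
- rewrite (_ : (fun x => _) = (fun x : R =>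
    cos (pi * x / 2) ^+ 2 * lommel 0 x a * lommel 0 x a)).
    by have := has_integral_lommel0_lommel0 a a; rewrite subrr besselJ0_0.
  by apply/funext => x; rewrite [lommel _ _ _ ^+ 2]expr2 mulrA.
- exact: has_integral_lommelN1_lommelN1.
- rewrite (_ : (fun x => _) = (fun x : R =>
    x ^+ 2 * sin (pi * x / 2) ^+ 2 * lommel (-1) x a * lommel (-1) x a)).
    by have := has_integral_lommelN1_lommelN1 a a; rewrite subrr besselJ0_0.
  by apply/funext => x; rewrite [lommel _ _ _ ^+ 2]expr2 mulrA.
Qed.
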